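(* Let $D$ be an integral domain and $\star$ a semistar operation on $D$. Suppose that $D$ is a $\widetilde{\star}$-Noetherian domain with $\widetilde{\star}\text{-}\dim(D)=n$, and let $m\ge 1$ be an integer. Then $$\star[X_1,\cdots,X_m]\text{-}\dim(D[X_1,\cdots,X_m])=n+m.$$
   Context: For a domain $D$ with quotient field $K$, $\overline{\mathcal F}(D)$ is the set of nonzero $D$-submodules of $K$ and $f(D)$ the set of nonzero finitely generated $D$-submodules of $K$. A semistar operation on $D$ is a map $\star:\overline{\mathcal F}(D)\to\overline{\mathcal F}(D)$, $E\mapsto E^\star$, such that for all $0\ne x\in K$ and $E,F\in\overline{\mathcal F}(D)$: $(xE)^\star=xE^\star$; $E\subseteq F$ implies $E^\star\subseteq F^\star$; $E\subseteq E^\star=(E^\star)^\star$. Define $E^{\star_f}:=\bigcup\{F^\star\mid F\in f(D),F\subseteq E\}$. A nonzero ideal $I$ of $D$ is a quasi-$\star$-ideal if $I^\star\cap D=I$; a quasi-$\star$-prime is a prime quasi-$\star$-ideal; $\operatorname{QMax}^{\star}(D)$ is the set of maximal elements of the set of proper quasi-$\star$-ideals (they are prime). $\widetilde\star$ is the semistar operation $E^{\widetilde\star}:=\bigcap\{ED_P\mid P\in\operatorname{QMax}^{\star_f}(D)\}$ (equal to $K$ if $\operatorname{QMax}^{\star_f}(D)=\emptyset$). $D$ is $\star$-Noetherian if it satisfies the ascending chain condition on quasi-$\star$-ideals. $\star\text{-}\dim(D)$ is the supremum of the integers $n$ such that there is a chain $(0)\subsetneq P_1\subsetneq\cdots\subsetneq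 P_n$ with each $P_i$ a quasi-$\star$-prime of $D$; it is $0$ if there are no quasi-$\star$-primes. Let $X,Y$ be indeterminates, $D_1:=D[X]$, $K_1:=K(X)$, $\Theta_1^{\star}:=\{Q\in\operatorname{Spec}(D_1)\mid Q\cap D=(0)\text{ or }(Q\cap D)^{\star_f}\subsetneq D^{\star}\}$, $\mathfrak S_1^\star:=D_1[Y]\setminus\bigcup\{Q[Y]\mid Q\in\Theta_1^\star\}$. The semistar operation $\star[X]$ on $D[X]$ is defined by $E^{\star[X]}:=E[Y]_{\mathfrak S_1^\star}\cap K_1$ for $E\in\overline{\mathcal F}(D_1)$. For indeterminates $X_1,\dots,X_r$, $r\ge2$, $\star[X_1,\cdots,X_r]:=(\star[X_1,\cdots,X_{r-1}])[X_r]$, a semistar operation on $D[X_1,\cdots,X_r]$. *)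

(* Defs.v *)
From HB Require Import structures.
From mathcomp Require Import all_boot all_order all_algebra.
From mathcomp Require Import fraction ring_quotient.
From mathcomp Require Import boolp classical_sets constructive_ereal.
Set Implicit Arguments.
Unset Strict Implicit.
Unset Printing Implicit Defensive.

Import Order.TTheory GRing.Theory Num.Theory.
Local Open Scope classical_set_scope.
Local Open Scope ring_scope.

Notation frac := (@FracField.tofrac _).

Section Semistar.
Variable D : idomainType.
Local Notation K := {fraction D}.

Definition submodule (E : set K) : Prop :=
  [/\ E 0, forall x y, E x -> E y -> E (x + y)
    & forall (d : D) x, E x -> E (frac d * x)].

Definition Fbar : set (set K) := [set E | submodule E /\ E <> [set 0]].

Definition span n (x : 'I_n -> K) : set K :=
  [set y | exists d : 'I_n -> D, y = \sum_(i < n) frac (d i) * x i].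

Definition fgmod : set (set K) :=
  [set F | (exists n (x : 'I_n -> K), F = span x) /\ F <> [set 0]].

(* Operations are total on [set K]; only their values on [Fbar] matter. *)
Definition semistar (star : set K -> set K) : Prop :=
  [/\ forall E, Fbar E -> Fbar (star E),
      forall (x : K) E, x != 0 -> Fbar E ->
        star ( *%R x @` E) = *%R x @` star E,
      forall E F, Fbar E -> Fbar F -> E `<=` F -> star E `<=` star F
    & forall E, Fbar E -> E `<=` star E /\ star (star E) = star E].

Definition star_f (star : set K -> set K) (E : set K) : set K :=
  \bigcup_(F in [set F | fgmod F /\ F `<=` E]) star F.

Definition ideal (I : set D) : Prop := GRing.submod_closed (mem (I : set D^o)).

Definition prime_ideal (P : set D) : Prop :=
  idealr_closed (mem P) /\ prime_idealr_closed (mem P).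

Definition quasi_ideal (star : set K -> set K) (I : set D) : Prop :=
  [/\ ideal I, I <> [set 0] & frac @^-1` star (frac @` I) = I].

Definition quasi_prime (star : set K -> set K) (P : set D) : Prop :=
  quasi_ideal star P /\ prime_ideal P.

Definition QMax (star : set K -> set K) : set (set D) :=
  [set M | [/\ quasi_ideal star M, M <> [set: D]
    & forall I, quasi_ideal star I -> I <> [set: D] -> M `<=` I -> I = M]].

Definition mulmod (E F : set K) : set K :=
  [set z | exists n (e f : 'I_n -> K),
    [/\ forall i, E (e i), forall i, F (f i) & z = \sum_(i < n) e i * f i]].

Definition loc (P : set D) : set K :=
  [set z | exists a s : D, ~ P s /\ z = frac a / frac s].

(* The intersection over an empty index set is [setT], i.e. K. *)
Definition tilde (star : set K -> set K) (E : set K) : set K :=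
  \bigcap_(P in QMax (star_f star)) mulmod E (loc P).

Definition star_noetherian (star : set K -> set K) : Prop :=
  forall I : nat -> set D,
    (forall k, quasi_ideal star (I k)) -> (forall k, I k `<=` I k.+1) ->
    exists N, forall k, (N <= k)%N -> I k = I N.

Definition prime_chain (star : set K -> set K) (n : nat) : Prop :=
  exists P : nat -> set D, P 0%N = [set 0] /\
    forall i, (i < n)%N -> P i `<` P i.+1 /\ quasi_prime star (P i.+1).

(* [prime_chain star 0] always holds, so the dimension is 0 when there is no
   quasi-star-prime; it is +oo when the lengths of chains are unbounded. *)
Definition star_dim (star : set K -> set K) : \bar int :=
  supremum 0%E [set (n%:Z)%:E | n in prime_chain star].

End Semistar.

(* E[Y], for a subset E of the coefficient ring. *)
Definition poly_set (R : nzRingType) (E : set R) : set {poly R} :=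
  [set p : {poly R} | forall i, E p`_i].

Section PolyStar.
Variables (D : idomainType) (star : set {fraction D} -> set {fraction D}).
Local Notation D1 := {poly D}.
Local Notation K1 := {fraction {poly D}}.

Definition Theta1 : set (set D1) :=
  [set Q | prime_ideal Q /\
    let QD : set D := polyC @^-1` Q in
    QD = [set 0] \/ star_f star (frac @` QD) `<` star (frac @` [set: D])].

Definition S1 : set {poly D1} := ~` \bigcup_(Q in Theta1) poly_set Q.

(* E[Y]_{S1}, inside K1(Y), the fraction field of K1[Y]. *)
Definition poly_loc (E : set K1) : set {fraction {poly K1}} :=
  [set z | exists (p : {poly K1}) (s : {poly D1}),
    [/\ poly_set E p, S1 s & z = frac p / frac (map_poly frac s)]].

Definition star_X (E : set K1) : set K1 :=
  (fun c : K1 => frac c%:P) @^-1` poly_loc E.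

End PolyStar.

Fixpoint mpolyring (D : idomainType) (m : nat) : idomainType :=
  if m is m'.+1 then {poly mpolyring D m'} else D.

Fixpoint star_Xs (D : idomainType) (star : set {fraction D} -> set {fraction D})
    (m : nat) : set {fraction (mpolyring D m)} -> set {fraction (mpolyring D m)} :=
  match m return set {fraction (mpolyring D m)} -> set {fraction (mpolyring D m)}
  with
  | 0%N => star
  | m'.+1 => star_X (@star_Xs D star m')
  end.

Arguments star_Xs {D} star m E.

(* Main.v *)
(* The nonzero primes Q of D[X_1,...,X_m] that are quasi-star[X_1,...,X_m]-primes
   are exactly those whose contraction to D is zero or contained in some M in
   QMax^{star_f}(D); for m = 0 these are the quasi-tilde(star)-primes. So the
   theorem is about the length of chains of such primes, and it suffices to show
   that the maximal length grows by exactly one with each indeterminate.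

   At each such prime P the tilde(star)-Noetherian hypothesis says that D_P is
   Noetherian, and this passes to polynomial rings by Hilbert's basis theorem.
   Localizations are never formed: ideals of D_P are represented by the ideals I
   of D that are saturated (s a in I and s notin P imply a in I).

   The dimension formula is then obtained as for strong S-domains: if P' < P are
   adjacent primes then so are P'[X] < P[X], by Krull's principal ideal theorem,
   whence ht P[X] = ht P and ht Q <= ht (Q cap A) + 1 for every prime Q of A[X]. *)

From HB Require Import structures.
From mathcomp Require Import all_boot all_order all_algebra.
From mathcomp Require Import fraction ring_quotient ring.
From mathcomp Require Import boolp classical_sets constructive_ereal.
Require Import Defs.
Set Implicit Arguments.
Unset Strict Implicit.
Unset Printing Implicit Defensive.
Import Order.TTheory GRing.Theory Num.Theory.
Local Open Scope classical_set_scope.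
Local Open Scope ring_scope.

(** * Ideals, saturation and Noetherian localizations *)

Section Ideals.
Variable A : idomainType.
Implicit Types (I J P Q S : set A) (a b x y z : A).

Lemma idealP I : ideal I <-> [/\ I 0, forall x y, I x -> I y -> I (x + y)
  & forall a x, I x -> I (a * x)].
Proof.
split=> [[]|[I0 ID IM]].
- move=> /set_mem I0 IL; split=> // [x y Ix Iy|a x Ix].
  + by have := set_mem (IL 1 x y (mem_set Ix) (mem_set Iy)); rewrite scale1r.
  + by have := set_mem (IL a x 0 (mem_set Ix) (mem_set I0)); rewrite addr0.
- split; first exact: mem_set.
  move=> a x y /set_mem Ix /set_mem Iy; apply: mem_set.
  by apply: ID => //; apply: IM.
Qed.

Lemma ideal0 I : ideal I -> I 0. Proof. by case/idealP. Qed.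

Lemma idealD I x y : ideal I -> I x -> I y -> I (x + y).
Proof. by case/idealP=> _ + _; apply. Qed.

Lemma idealMl I a x : ideal I -> I x -> I (a * x).
Proof. by case/idealP=> _ _; apply. Qed.

Lemma idealMr I a x : ideal I -> I x -> I (x * a).
Proof. by rewrite mulrC; apply: idealMl. Qed.

Lemma idealN I x : ideal I -> I x -> I (- x).
Proof. by move=> iI Ix; rewrite -mulN1r; apply: idealMl. Qed.

Lemma idealB I x y : ideal I -> I x -> I y -> I (x - y).
Proof. by move=> iI Ix Iy; apply: idealD => //; apply: idealN. Qed.

Lemma ideal_sum I (T : Type) (r : seq T) (p : pred T) (F : T -> A) :
  ideal I -> (forall i, p i -> I (F i)) -> I (\sum_(i <- r | p i) F i).
Proof.
by move=> iI IF; elim/big_ind: _ => //; [exact: ideal0|move=> x y; exact: idealD].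
Qed.

Lemma prime_idealE P : prime_ideal P <->
  [/\ ideal P, ~ P 1 & forall x y, P (x * y) -> P x \/ P y].
Proof.
split=> [[[/set_mem P0 P1 PL] PM]|[iP P1 PM]].
- split.
  + by split; [exact: mem_set|].
  + by move=> /mem_set h; case/negP: P1.
  + by move=> x y /mem_set/PM/orP[]/set_mem; [left|right].
- split; first split.
  + by apply: mem_set; apply: ideal0.
  + by apply/negP => /set_mem.
  + by case: iP.
  + move=> x y /set_mem/PM[] h; apply/orP; [left|right]; exact: mem_set.
Qed.

Lemma prime_ideal_ideal P : prime_ideal P -> ideal P.
Proof. by case/prime_idealE. Qed.

Lemma prime_ideal1 P : prime_ideal P -> ~ P 1.
Proof. by case/prime_idealE. Qed.

Lemma prime_idealM P x y : prime_ideal P -> P (x * y) -> P x \/ P y.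
Proof. by case/prime_idealE=> _ _; apply. Qed.

Lemma prime_idealMN P x y : prime_ideal P -> ~ P x -> ~ P y -> ~ P (x * y).
Proof. by move=> pP Px Py /(prime_idealM pP)[]. Qed.

Lemma prime_idealXN P x k : prime_ideal P -> ~ P x -> ~ P (x ^+ k).
Proof.
move=> pP Px; elim: k => [|k ih]; first by rewrite expr0; exact: prime_ideal1.
by rewrite exprS; apply: prime_idealMN.
Qed.

Lemma prime_ideal_zero : prime_ideal [set 0 : A].
Proof.
apply/prime_idealE; split.
- apply/idealP; split=> //= [x y -> ->|a x ->]; by rewrite ?addr0 ?mulr0.
- by move/eqP; rewrite oner_eq0.
- by move=> x y /eqP; rewrite mulf_eq0 => /orP[]/eqP; [left|right].
Qed.

Definition saturated S I := forall s a, S s -> I (s * a) -> I a.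

Definition sat_ideal S I := ideal I /\ saturated S I.

(** For [S] the complement of a prime this says that the localization is Noetherian. Other [S] occur
    too: the basis theorem yields it for the image of [S] under [polyC]. *)
Definition sat_noetherian S := forall I : nat -> set A,
  (forall k, sat_ideal S (I k)) -> (forall k, I k `<=` I k.+1) ->
  exists N, forall k, (N <= k)%N -> I k = I N.

Lemma sat_noetherianS S S' : S `<=` S' -> sat_noetherian S -> sat_noetherian S'.
Proof.
move=> SS' nS I sI; apply: nS => k; have [iI s] := sI k.
by split=> // t a /SS'; apply: s.
Qed.

(** A family without a maximal element would, by choice, yield a strictly increasing sequence. *)
Lemma sat_noetherian_max S (F : set (set A)) : sat_noetherian S ->
  F `<=` sat_ideal S -> F !=set0 ->
  exists2 I, F I & forall J, F J -> I `<=` J -> J = I.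
Proof.
move=> nS FS [I0 FI0]; apply: contrapT => /forall2NP nomax.
have step (I : set A) : exists J, F I -> F J /\ I `<` J.
  have [nFI|/existsNP[J /not_implyP[FJ /not_implyP[IJ neq]]]] := nomax I.
    by exists I.
  by exists J => _; split=> //; split=> // JI; apply: neq; apply/seteqP.
have {step} [g gP] := choice step.
pose c k := iter k g I0.
have Fc k : F (c k) by elim: k => //= k /gP[].
have [N cN] := nS c (fun k => FS _ (Fc k)) (fun k => proj1 (proj2 (gP _ (Fc k)))).
have [_ [_]] := gP _ (Fc N); apply.
by rewrite -[g _]/(c N.+1) cN.
Qed.

(* The saturation of [I + (x)] with respect to the complement of P. *)
Definition sat_add P x I : set A := [set z | exists s b, ~ P s /\ I (s * z - b * x)].

Lemma sat_add_ideal P x I : prime_ideal P -> ideal I ->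
  sat_ideal (~` P) (sat_add P x I).
Proof.
move=> pP iI; split; first (apply/idealP; split).
- exists 1, 0; split; first exact: prime_ideal1.
  by rewrite mulr0 mul0r subrr; apply: ideal0.
- move=> y z [s [b [Ps Iy]]] [t [c [Pt Iz]]].
  exists (s * t), (t * b + s * c); split; first exact: prime_idealMN.
  have -> : s * t * (y + z) - (t * b + s * c) * x =
    t * (s * y - b * x) + s * (t * z - c * x) by ring.
  by apply: idealD => //; apply: idealMl.
- move=> a y [s [b [Ps Iy]]]; exists s, (a * b); split=> //.
  have -> : s * (a * y) - a * b * x = a * (s * y - b * x) by ring.
  exact: idealMl.
- move=> s y Ps [t [b [Pt Iy]]]; exists (t * s), b.
  by split; [exact: prime_idealMN|rewrite -mulrA].
Qed.

Lemma sub_sat_add P x I : prime_ideal P -> I `<=` sat_add P x I.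
Proof.
move=> pP y Iy; exists 1, 0; split; first exact: prime_ideal1.
by rewrite mul1r mul0r subr0.
Qed.

Lemma mem_sat_add P x I : prime_ideal P -> ideal I -> sat_add P x I x.
Proof.
move=> pP iI; exists 1, 1; split; first exact: prime_ideal1.
by rewrite subrr; apply: ideal0.
Qed.

Lemma sat_addS P x I J : I `<=` J -> sat_add P x I `<=` sat_add P x J.
Proof. by move=> IJ y [s [b [Ps /IJ]]]; exists s, b. Qed.

Definition sat_colon I x : set A := [set b | I (b * x)].

Lemma sat_colon_ideal S I x : sat_ideal S I -> sat_ideal S (sat_colon I x).
Proof.
move=> [iI sI]; split; first (apply/idealP; split).
- by rewrite /sat_colon /= mul0r; apply: ideal0.
- by move=> a b Ia Ib; rewrite /sat_colon /= mulrDl; apply: idealD.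
- by move=> a b Ib; rewrite /sat_colon /= -mulrA; apply: idealMl.
- by move=> s b Ss; rewrite /sat_colon /= -mulrA; apply: sI.
Qed.

(* An associated prime of A/I at P; by the assumption on J it can only be P. *)
Lemma colon_eq_prime P J I : prime_ideal P -> sat_noetherian (~` P) ->
  (forall q, prime_ideal q -> J `<=` q -> q `<=` P -> q = P) ->
  sat_ideal (~` P) I -> J `<=` I -> ~ I 1 ->
  exists2 x, ~ I x & sat_colon I x = P.
Proof.
move=> pP nP Jmin sI JI I1.
have [||_ [x nIx <-] xmax] := @sat_noetherian_max (~` P)
  [set sat_colon I x | x in ~` I] nP.
- by move=> _ [x _ <-]; apply: sat_colon_ideal.
- by exists (sat_colon I 1); exists 1.
exists x => //; have [iI satI] := sI; apply: Jmin.
- apply/prime_idealE; split; first by case: (sat_colon_ideal x sI).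
    by rewrite /sat_colon /= mul1r.
  move=> u v uv; case: (pselect (I (u * x))) => [|nu]; first by left.
  (* The ideal (I : ux) contains (I : x), so maximality makes them equal, and [v] lies in the
     former. *)
  right; rewrite -(xmax (sat_colon I (u * x))); last 2 first.
  + by exists (u * x).
  + by move=> b; rewrite /sat_colon /= mulrCA; apply: idealMl.
  by rewrite /sat_colon /= mulrA [v * u]mulrC.
- by move=> j /JI Ij; apply: idealMr.
- by move=> s sx; apply: contrapT => Ps; apply: nIx; apply: satI sx.
Qed.

(* The localization of A/J at P is Artinian when P is minimal over J. *)
Lemma sat_artinian P J (c : nat -> set A) : prime_ideal P ->
  sat_noetherian (~` P) ->
  (forall q, prime_ideal q -> J `<=` q -> q `<=` P -> q = P) ->
  (forall k, sat_ideal (~` P) (c k)) -> (forall k, J `<=` c k) ->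
  (forall k, c k.+1 `<=` c k) -> exists N, c N `<=` c N.+1.
Proof.
move=> pP nP Jmin.
pose art I := forall c : nat -> set A, (forall k, sat_ideal (~` P) (c k)) ->
  (forall k, I `<=` c k) -> (forall k, c k.+1 `<=` c k) ->
  exists N, forall k, (N <= k)%N -> c N `<=` c k.
(* [J] is only a set, so the claim is applied to the intersection of the chain, a saturated ideal
   containing [J]. *)
suff artJ I : sat_ideal (~` P) I -> J `<=` I -> art I.
  move=> sc Jc dc; have [|||||N cN] := artJ (\bigcap_k c k) _ _ c => //.
  - split; first (apply/idealP; split).
    + by move=> k _; apply: ideal0; case: (sc k).
    + move=> x y cx cy k _; apply: idealD; [by case: (sc k)|exact: cx|exact: cy].
    + move=> a x cx k _; apply: idealMl; [by case: (sc k)|exact: cx].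
    + move=> s a Ps csa k _; have [_] := sc k; apply; [exact: Ps|exact: csa].
  - by move=> x Jx k _; apply: Jc.
  - by move=> k x; apply.
  - by exists N; apply: cN.
(* Noetherian induction: [I] becomes a maximal counterexample, to which an [x] with (I : x) = P is
   adjoined. *)
move=> sI0 JI0; apply: contrapT => nart.
have [||{I sI0 JI0 nart}I [sI JI nart] Imax] := @sat_noetherian_max (~` P)
  [set I | [/\ sat_ideal (~` P) I, J `<=` I & ~ art I]] nP.
- by move=> ? [].
- by exists I.
have nI1 : ~ I 1.
  move=> I1; apply: nart => c' sc' Ic' _; exists 0%N => k _ x _.
  rewrite -[x]mulr1; apply: idealMl; first by case: (sc' k).
  exact: Ic'.
have [x nIx colP] := colon_eq_prime pP nP Jmin sI JI nI1.
have [iI satI] := sI.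
have artx : art (sat_add P x I).
  apply: contrapT => nartx; apply: nIx.
  rewrite -(Imax (sat_add P x I)); first exact: mem_sat_add.
  - split=> //; first exact: sat_add_ideal.
    by apply: subset_trans JI _; apply: sub_sat_add.
  - exact: sub_sat_add.
apply: nart => {}c sc Ic dc.
have dc' i j : (i <= j)%N -> c j `<=` c i.
  move=> /subnK <-; elim: (j - i)%N => // k ih.
  by rewrite addSn; apply: subset_trans (dc _) ih.
have [N cN] : exists N, forall k, (N <= k)%N ->
    sat_add P x (c N) `<=` sat_add P x (c k).
  apply: artx => k; first by apply: sat_add_ideal => //; case: (sc k).
    exact: sat_addS.
  exact: sat_addS.
(* Modulo [x] the chain is stable from [N] on. If [x] is in every term, this is stability itself. If
   [c M] misses [x], a coefficient [b] with [b * x] in [c M] must lie in [P], which is (I : x), so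
   [b * x] is already in [I]. *)
have [cx|/existsNP[M nxM]] := pselect (forall k, c k x).
  exists N => k Nk z cz; have [ick sck] := sc k.
  have [s [b [Ps csb]]] := cN k Nk z (sub_sat_add _ pP cz).
  apply: (sck s) => //; rewrite -[s * z](subrK (b * x)).
  by apply: idealD => //; apply: idealMl.
exists (maxn N M) => k Nk z cz; have [ick sck] := sc k.
have [icM scM] := sc M.
have cNz : c N z by apply: dc' cz; apply: leq_maxl.
have [s [b [Ps csb]]] := cN k (leq_trans (leq_maxl _ _) Nk) z (sub_sat_add _ pP cNz).
have cMbx : c M (b * x).
  have -> : b * x = s * z - (s * z - b * x) by ring.
  apply: idealB => //.
    by apply: idealMl => //; apply: dc' cz; apply: leq_maxr.
  by apply: dc' csb; apply: leq_trans (leq_maxr _ _) Nk.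
have Pb : P b by apply: contrapT => Pb; apply: nxM; apply: scM cMbx.
apply: (sck s) => //; rewrite -[s * z](subrK (b * x)).
by apply: idealD => //; apply: Ic; rewrite -colP in Pb.
Qed.

(** Nakayama's lemma for M = U + aM at [P], without generators: a maximal [V] between [U] and [M]
    that differs from [M] makes M/V cyclic, generated by some [z]. Then (st - ab)z is in [V], where
    st - ab is outside [P] because [a] is in [P]. *)
Lemma sat_nakayama P a U M : prime_ideal P -> sat_noetherian (~` P) -> P a ->
  sat_ideal (~` P) U -> sat_ideal (~` P) M -> U `<=` M ->
  (forall z, M z -> exists s m, [/\ ~ P s, M m & U (s * z - a * m)]) -> M `<=` U.
Proof.
move=> pP nP Pa sU sM UM MaM; apply: contrapT => nMU.
have [||V [sV UV VM nMV] Vmax] := @sat_noetherian_max (~` P)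
  [set V | [/\ sat_ideal (~` P) V, U `<=` V, V `<=` M & ~ M `<=` V]] nP.
- by move=> ? [].
- by exists U; split.
have [z /not_implyP[Mz nVz]] : exists z, ~ (M z -> V z) by apply/existsNP.
have [[iV satV] [iM satM]] := (sV, sM).
have Mz' : M `<=` sat_add P z V.
  apply: contrapT => nM; apply: nVz; rewrite -(Vmax (sat_add P z V)).
  - exact: mem_sat_add.
  - split=> //; first exact: sat_add_ideal.
      by apply: subset_trans UV _; apply: sub_sat_add.
    move=> y [s [b [Ps /VM Msb]]]; apply: (satM s) => //.
    by rewrite -[s * y](subrK (b * z)); apply: idealD => //; apply: idealMl.
  - exact: sub_sat_add.
have [t [m [Pt /Mz' [s [b [Ps Vm]]] /UV Vt]]] := MaM z Mz.
apply: nVz; apply: (satV (s * t - a * b)).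
  move=> Pst; apply: (prime_idealMN pP Ps Pt); rewrite -[s * t](subrK (a * b)).
  by have iP := prime_ideal_ideal pP; apply: idealD => //; apply: idealMr.
have -> : (s * t - a * b) * z = s * (t * z - a * m) + a * (s * m - b * z) by ring.
by apply: idealD => //; apply: idealMl.
Qed.

End Ideals.

Lemma chain_subset (T : Type) (c : nat -> set T) :
  (forall k, c k `<=` c k.+1) -> forall i j, (i <= j)%N -> c i `<=` c j.
Proof.
move=> cS i j /subnK <-; elim: (j - i)%N => // k ih.
by rewrite addSn; apply: subset_trans ih _.
Qed.

(** * Polynomial rings *)

Section HilbertBasis.
Variables (A : idomainType) (S : set A).
Hypotheses (S1 : S 1) (SM : forall s t, S s -> S t -> S (s * t)).
Implicit Types J : set {poly A}.

(** Leading coefficients in degree [d]; the size bound admits lower degrees, hence the coefficient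
    0, and the multiplier [s] makes the ideal saturated. *)
Definition sat_lead J d : set A :=
  [set a | exists s (f : {poly A}),
    [/\ S s, J f, (size f <= d.+1)%N & f`_d = s * a]].

Lemma sat_lead_ideal J d : ideal J -> sat_ideal S (sat_lead J d).
Proof.
move=> iJ; split; first (apply/idealP; split).
- by exists 1, 0; split; rewrite ?size_poly0 ?coef0 ?mulr0 //; apply: ideal0.
- move=> a b [s [f [Ss Jf sf fd]]] [t [g [St Jg sg gd]]].
  exists (s * t), (t%:P * f + s%:P * g); split.
  + exact: SM.
  + by apply: idealD => //; apply: idealMl.
  + apply: leq_trans (size_polyD _ _) _; rewrite geq_max !mul_polyC.
    by rewrite !(leq_trans (size_scale_leq _ _)).
  + by rewrite coefD !coefCM fd gd; ring.
- move=> b a [s [f [Ss Jf sf fd]]]; exists s, (b%:P * f); split=> //.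
  + exact: idealMl.
  + by rewrite mul_polyC (leq_trans (size_scale_leq _ _)).
  + by rewrite coefCM fd; ring.
- move=> t a St [s [f [Ss Jf sf fd]]]; exists (s * t), f; split=> //.
  + exact: SM.
  + by rewrite fd mulrA.
Qed.

Lemma sat_leadS J J' d : J `<=` J' -> sat_lead J d `<=` sat_lead J' d.
Proof. by move=> JJ' a [s [f [Ss /JJ' Jf sf fd]]]; exists s, f. Qed.

Lemma sat_lead_succ J d : ideal J -> sat_lead J d `<=` sat_lead J d.+1.
Proof.
move=> iJ a [s [f [Ss Jf sf fd]]]; exists s, (f * 'X); split=> //.
- exact: idealMr.
- have [->|f0] := eqVneq f 0; first by rewrite mul0r size_poly0.
  by rewrite size_mulX.
- by rewrite coefMX.
Qed.

(** Induction on the size of [f]: as [J] is saturated it suffices to treat [s%:P * f], whose leading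
    term is cancelled by some [g] in [J]. *)
Lemma sat_lead_inj J J' : sat_ideal (polyC @` S) J -> ideal J' -> J `<=` J' ->
  (forall d, sat_lead J' d `<=` sat_lead J d) -> J' `<=` J.
Proof.
move=> [iJ sJ] iJ' JJ' leadJ f.
have [d] := ubnP (size f); elim: d f => // d IH f; rewrite ltnS => sf J'f.
have [f0|d_gt0] := leqP (size f) 0.
  by move: f0; rewrite leqn0 size_poly_eq0 => /eqP ->; apply: ideal0.
have [s [g [Ss Jg sg gd]]] : sat_lead J (size f).-1 (f`_(size f).-1).
  by apply: leadJ; exists 1, f; split=> //; [rewrite prednK|rewrite mul1r].
apply: (sJ s%:P); first by exists s.
rewrite -[_ * f](subrK g); apply: idealD => //; apply: IH; last first.
  by apply: idealB => //; [apply: idealMl|apply: JJ'].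
apply: leq_trans sf; rewrite -[X in (_ < X)%N](prednK d_gt0) ltnS.
apply/leq_sizeP => j; rewrite leq_eqVlt coefB coefCM => /orP[/eqP <-|dj].
  by rewrite gd subrr.
rewrite prednK // in sg; rewrite prednK // in dj.
by rewrite !nth_default ?mulr0 ?subrr // (leq_trans sg).
Qed.

(** The ideals [L d k] increase in both indices. The diagonal is constant from some [N] on, which
    settles all degrees from [N] on at once; the finitely many lower degrees are stabilized one by
    one. *)
Lemma poly_sat_noetherian : sat_noetherian S -> sat_noetherian (polyC @` S).
Proof.
move=> nS J sJ JS; have iJ k := proj1 (sJ k).
pose L d k := sat_lead (J k) d.
have sL d k : sat_ideal S (L d k) by apply: sat_lead_ideal.
have LJ d i j : (i <= j)%N -> L d i `<=` L d j.
  by move=> ij; apply: sat_leadS; apply: chain_subset.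
have Ld k i j : (i <= j)%N -> L i k `<=` L j k.
  by apply: (@chain_subset _ (L^~ k)) => d; apply: sat_lead_succ.
have [N diagN] : exists N, forall k, (N <= k)%N -> L k k = L N N.
  apply: nS => // k; apply: subset_trans (Ld _ _ _ (leqnSn k)) _.
  exact: LJ.
have [M0 M0P] : exists M0 : nat -> nat, forall d k, (M0 d <= k)%N -> L d k = L d (M0 d).
  have /choice[M0 M0P] d : exists M, forall k, (M <= k)%N -> L d k = L d M.
    by apply: nS => // k; apply: LJ.
  by exists M0.
(* The sum serves as a common upper bound for the ranks [M0 d] with d < N. *)
pose M := (N + \sum_(d < N) M0 d)%N.
exists M => k Mk; apply/seteqP; split; last exact: chain_subset.
apply: sat_lead_inj => //; first exact: chain_subset.
move=> d; rewrite -!/(L d _); have [dN|Nd] := ltnP d N.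
  have M0M : (M0 d <= M)%N.
    by rewrite /M (bigD1 (Ordinal dN)) //= addnCA leq_addr.
  by rewrite (M0P _ M) // (M0P _ k) //; apply: leq_trans Mk.
(* In degree d >= N, [L d k] lies in a diagonal term beyond [N], which equals [L N N] and is thus
   inside [L d N]. *)
apply: (@subset_trans _ (L (maxn d k) (maxn d k))).
  apply: (@subset_trans _ (L d (maxn d k))).
    by apply: LJ; apply: leq_maxr.
  by apply: Ld; apply: leq_maxl.
rewrite diagN; last by rewrite (leq_trans Nd) // leq_maxl.
by apply: (@subset_trans _ (L d N)); [apply: Ld|apply: LJ; apply: leq_addr].
Qed.

End HilbertBasis.

(** * Primes of A[X] over a given prime of A *)

Section PolyPrimes.
Variable A : idomainType.
Implicit Types (P : set A) (Q : set {poly A}) (f g : {poly A}).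

Lemma poly_set_ideal P : ideal P -> ideal (poly_set P).
Proof.
move=> iP; apply/idealP; split.
- by move=> i; rewrite coef0; apply: ideal0.
- by move=> f g Pf Pg i; rewrite coefD; apply: idealD.
- by move=> f g Pg i; rewrite coefM; apply: ideal_sum => // j _; apply: idealMl.
Qed.

Lemma poly_set_prime P : prime_ideal P -> prime_ideal (poly_set P).
Proof.
move=> pP; have iP := prime_ideal_ideal pP.
apply/prime_idealE; split; first exact: poly_set_ideal.
  by move=> /(_ 0%N); rewrite coef1 /=; apply: prime_ideal1.
move=> f g fg; apply: contrapT => /not_orP[].
move=> /existsNP/cid[i0 /asboolPn nfi0] /existsNP/cid[j0 /asboolPn ngj0].
(* Gauss's argument: for the least [i] and [j] whose coefficients of [f] and [g] are outside [P],
   the coefficient of index i + j of the product is their product plus terms in [P]. *)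
have [i /asboolPn nfi mini] := ex_minnP (ex_intro (fun i => ~~ `[<P f`_i>]) _ nfi0).
have [j /asboolPn ngj minj] := ex_minnP (ex_intro (fun j => ~~ `[<P g`_j>]) _ ngj0).
have := fg (i + j)%N; rewrite coefM.
have lt_i : (i < (i + j).+1)%N by rewrite ltnS leq_addr.
rewrite (bigD1 (Ordinal lt_i)) //= addKn.
set s := \sum_(_ < _ | _) _ => Ps.
apply: (prime_idealMN pP nfi ngj); rewrite -[_ * _](addrK s).
apply: idealB => //; apply: ideal_sum => // k; rewrite -val_eqE /= => ki.
have [lki|] := ltnP k i.
  apply: idealMr => //; apply: contrapT => /asboolPn/mini.
  by rewrite leqNgt lki.
rewrite leq_eqVlt eq_sym (negPf ki) /= => lik.
apply: idealMl => //; apply: contrapT => /asboolPn/minj.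
rewrite leqNgt ltn_subLR; last by rewrite -ltnS.
by rewrite ltn_add2r lik.
Qed.

Definition contraction Q : set A := polyC @^-1` Q.

Lemma contraction_prime Q : prime_ideal Q -> prime_ideal (contraction Q).
Proof.
move=> pQ; have iQ := prime_ideal_ideal pQ.
apply/prime_idealE; split; first (apply/idealP; split).
- by rewrite /contraction /= polyC0; apply: ideal0.
- by move=> x y Qx Qy; rewrite /contraction /= polyCD; apply: idealD.
- by move=> x y Qy; rewrite /contraction /= polyCM; apply: idealMl.
- by rewrite /contraction /= polyC1; apply: prime_ideal1.
- by move=> x y; rewrite /contraction /= polyCM; apply: prime_idealM.
Qed.

Lemma contraction_poly_set P : ideal P -> contraction (poly_set P) = P.
Proof.
move=> iP; apply/seteqP; split=> x; first by move=> /(_ 0%N); rewrite coefC.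
by move=> Px i; rewrite coefC; case: ifP => // _; apply: ideal0.
Qed.

Lemma contractionS Q Q' : Q `<=` Q' -> contraction Q `<=` contraction Q'.
Proof. by move=> QQ' x; apply: QQ'. Qed.

Lemma poly_setS (R : nzRingType) (P P' : set R) : P `<=` P' -> poly_set P `<=` poly_set P'.
Proof. by move=> PP' f Pf i; apply: PP'; apply: Pf. Qed.

Lemma poly_set_sub P Q : ideal Q -> P `<=` contraction Q -> poly_set P `<=` Q.
Proof.
move=> iQ PQ f Pf; rewrite -[f]coefK poly_def; apply: ideal_sum => // i _.
by rewrite -mul_polyC; apply: idealMr => //; apply: PQ; apply: Pf.
Qed.

(* Q/P[X] becomes principal, generated by f, over the residue field of P. *)
Lemma poly_prime_generator P Q : prime_ideal P -> ideal Q ->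
  poly_set P `<=` Q -> contraction Q = P -> Q <> poly_set P ->
  exists f, [/\ Q f, ~ poly_set P f, ~ P (lead_coef f),
    forall g, Q g -> ~ poly_set P g -> (size f <= size g)%N
    & forall g, Q g -> exists s q, [/\ ~ P s, poly_set P (s%:P * g - q * f)
      & size q = (size g - (size f).-1)%N]].
Proof.
move=> pP iQ PQ QP neq; have iP := prime_ideal_ideal pP.
have ipP := poly_set_ideal iP.
have /existsNP[f0 /not_implyP[Qf0 nPf0]] : ~ (Q `<=` poly_set P).
  by move=> QP'; apply: neq; apply/seteqP.
pose p n := `[<exists f, [/\ Q f, ~ poly_set P f & size f = n]>].
have [n /asboolP[f [Qf nPf <-]] nmin] :
    ex_minn_spec p (ex_minn (ex_intro p (size f0) (asboolT (ex_intro _ f0 (And3 Qf0 nPf0 erefl))))).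
  exact: ex_minnP.
have fmin g : Q g -> ~ poly_set P g -> (size f <= size g)%N.
  by move=> Qg nPg; apply: nmin; apply/asboolP; exists g.
have f_neq0 : f != 0 by apply/eqP => f0'; apply: nPf; rewrite f0'; apply: ideal0.
have nPlf : ~ P (lead_coef f).
  (* Otherwise dropping the leading term would give a shorter element of [Q] outside P[X]. *)
  move=> Plf; pose t := (lead_coef f)%:P * 'X^((size f).-1).
  have Pt : poly_set P t.
    by move=> i; rewrite coefCM; apply: idealMr.
  have := fmin (f - t) (idealB iQ Qf (PQ _ Pt)).
  have nPft : ~ poly_set P (f - t).
    by move=> Pft; apply: nPf; rewrite -[f](subrK t); apply: (idealD ipP).
  move=> /(_ nPft); apply/negP; rewrite -ltnNge.
  rewrite -[X in (_ < X)%N]prednK ?size_poly_gt0 // ltnS.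
  apply/leq_sizeP => j; rewrite leq_eqVlt /t coefB coefCM coefXn => /orP[/eqP <-|].
    by rewrite eqxx mulr1 subrr.
  rewrite prednK ?size_poly_gt0 // => dj; rewrite nth_default // sub0r.
  by rewrite gtn_eqF ?mulr0 ?oppr0 // prednK ?size_poly_gt0.
exists f; split=> // g Qg.
(* Pseudo-division: the multiplier is a power of the leading coefficient, hence outside [P]; the
   remainder is in [Q] and shorter than [f], hence in P[X]. *)
exists (lead_coef f ^+ scalp g f), (g %/ f).
split; [exact: prime_idealXN| |exact: Pdiv.Idomain.size_divp].
rewrite mul_polyC Pdiv.Idomain.divp_eq addrC addKr.
apply: contrapT => nPr; suff: (size f <= size (g %% f)%R)%N.
  by rewrite leqNgt Pdiv.Idomain.ltn_modp f_neq0.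
apply: fmin => //.
rewrite -[g %% f](addrK (g %/ f * f)) addrC [_ + g %/ f * f]addrC.
rewrite -Pdiv.Idomain.divp_eq addrC; apply: idealB => //.
  by rewrite -mul_polyC; apply: idealMl.
exact: idealMl.
Qed.

(** Polynomials over the residue field of [P] form a principal ideal domain, where nonzero primes
    are maximal. Concretely, the generator [f'] of [Q'] is, up to a constant, a multiple [q * f] of
    that of [Q] modulo P[X]; since [f] is not in [Q'], [q] is. *)
Lemma poly_prime_incomparable P Q' Q : prime_ideal P -> prime_ideal Q' -> prime_ideal Q ->
  contraction Q' = P -> contraction Q = P -> Q' `<` Q -> Q' = poly_set P.
Proof.
move=> pP pQ' pQ Q'P QP [Q'Q nQQ']; apply: contrapT => neq.
have [iP iQ' iQ] := And3 (prime_ideal_ideal pP) (prime_ideal_ideal pQ') (prime_ideal_ideal pQ).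
have PQ' : poly_set P `<=` Q' by apply: poly_set_sub; rewrite ?Q'P.
have PQ : poly_set P `<=` Q by apply: subset_trans Q'Q.
have neqQ : Q <> poly_set P by move=> Q_eq; apply: nQQ'; rewrite Q_eq.
have [f' [Q'f' nPf' _ minf' _]] := poly_prime_generator pP iQ' PQ' Q'P neq.
have [f [Qf nPf _ minf genf]] := poly_prime_generator pP iQ PQ QP neqQ.
have nQ's s : ~ P s -> ~ Q' s%:P by rewrite -Q'P.
have [s [q [Ps Pq sq]]] := genf f' (Q'Q _ Q'f').
have Q'qf : Q' (q * f).
  have -> : q * f = s%:P * f' - (s%:P * f' - q * f) by ring.
  by apply: idealB => //; [apply: idealMl|apply: PQ'].
have nQ'f : ~ Q' f.
  move=> Q'f; apply: nQQ' => g /genf[t [r [Pt Ptr _]]].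
  have : Q' (t%:P * g).
    rewrite -[_ * _](subrK (r * f)); apply: idealD; [by []|exact: PQ'|exact: idealMl].
  by case/(prime_idealM pQ') => // /nQ's.
have Q'q : Q' q by case: (prime_idealM pQ' Q'qf) => // /nQ'f.
have nPq : ~ poly_set P q.
  move=> Pq'; have : poly_set P (s%:P * f').
    rewrite -[_ * _](subrK (q * f)); apply: (idealD (poly_set_ideal iP)) => //.
    exact: (idealMr _ (poly_set_ideal iP)).
  case/(prime_idealM (poly_set_prime pP)) => //.
  by move=> /(_ 0%N); rewrite coefC.
(* Minimality makes [q] at least as long as [f'], so [f] is constant; but the constants of [Q] lie
   in [P]. *)
have := minf' _ Q'q nPq; rewrite sq leqNgt => /negP; apply.
have f'_gt0 : (0 < size f')%N.
  rewrite size_poly_gt0; apply/eqP => f'0; apply: nPf'; rewrite f'0.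
  exact: (ideal0 (poly_set_ideal iP)).
rewrite -subn_gt0 subKn; last first.
  by apply: leq_trans (leq_pred _) _; apply: minf => //; apply: Q'Q.
rewrite -subn1 subn_gt0 ltnNge; apply/negP => /size1_polyC fC.
apply: nPf => i; rewrite fC coefC; case: ifP => _; last exact: ideal0.
by rewrite -QP /contraction /= -fC.
Qed.

End PolyPrimes.

(** * Symbolic powers and Krull's principal ideal theorem *)

Section KrullPoly.
Variable A : idomainType.
Implicit Types (P : set A) (Q : set {poly A}).

(** With P = Q ∩ A, the localization of A[X] at [Q] is a further localization of A_P[X]. *)
Lemma contraction_sat_noetherian Q : prime_ideal Q ->
  sat_noetherian (~` contraction Q) -> sat_noetherian (~` Q).
Proof.
move=> /contraction_prime pP nP; apply: (@sat_noetherianS _ (polyC @` (~` contraction Q))).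
  by move=> _ [s Ps <-].
apply: poly_sat_noetherian => //; first exact: prime_ideal1.
by move=> s t; apply: prime_idealMN.
Qed.

(* The k-th symbolic power of Q, where Q/P[X] is generated by f over the
   residue field of P. *)
Let symb P (f : {poly A}) k : set {poly A} :=
  [set z | exists s q, ~ P s /\ poly_set P (s%:P * z - q * f ^+ k)].

Let symb_ideal P f k : prime_ideal P -> ideal (symb P f k).
Proof.
move=> pP; have ipP := poly_set_ideal (prime_ideal_ideal pP).
apply/idealP; split.
- exists 1, 0; split; first exact: prime_ideal1.
  by rewrite mulr0 mul0r subrr; apply: (ideal0 ipP).
- move=> y z [s [q [Ps Py]]] [t [r [Pt Pz]]].
  exists (s * t), (t%:P * q + s%:P * r); split; first exact: prime_idealMN.
  have -> : (s * t)%:P * (y + z) - (t%:P * q + s%:P * r) * f ^+ k =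
    t%:P * (s%:P * y - q * f ^+ k) + s%:P * (t%:P * z - r * f ^+ k).
    by rewrite polyCM; ring.
  by apply: (idealD ipP); apply: (idealMl _ ipP).
- move=> a y [s [q [Ps Py]]]; exists s, (a * q); split=> //.
  have -> : s%:P * (a * y) - a * q * f ^+ k = a * (s%:P * y - q * f ^+ k) by ring.
  exact: (idealMl _ ipP).
Qed.

Let symb_satC P f k s z : prime_ideal P -> ~ P s -> symb P f k (s%:P * z) -> symb P f k z.
Proof.
move=> pP Ps [t [q [Pt Pz]]]; exists (t * s), q; split; first exact: prime_idealMN.
by rewrite polyCM -mulrA.
Qed.

Let symbS P f k : symb P f k.+1 `<=` symb P f k.
Proof. by move=> z [s [q [Ps Pz]]]; exists s, (q * f); rewrite -mulrA -exprS. Qed.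

(** By induction [z] is, up to a constant outside [P], congruent to [w * f ^+ k]. Cancelling
    [f ^+ k] modulo the prime P[X] shows that [w] is in [Q], hence contributes one more factor
    [f]. *)
Let symb_sat P Q f k t z : prime_ideal P -> prime_ideal Q ->
  poly_set P `<=` Q -> contraction Q = P -> Q f -> ~ poly_set P f ->
  (forall g, Q g -> symb P f 1 g) ->
  ~ Q t -> symb P f k (t * z) -> symb P f k z.
Proof.
move=> pP pQ PQ QP Qf nPf Q1 nQt.
have [ipP iQ] := (poly_set_ideal (prime_ideal_ideal pP), prime_ideal_ideal pQ).
elim: k => [_|k IH sz].
  exists 1, z; split; first exact: prime_ideal1.
  by rewrite mul1r expr0 mulr1 subrr; apply: (ideal0 ipP).
have [s [w [Ps Pw]]] := IH (symbS sz).
have [r [q [Pr Pq]]] := sz.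
have Pqw : poly_set P (r%:P * t * w - s%:P * q * f).
  have /(prime_idealM (poly_set_prime pP))[//|] : poly_set P ((r%:P * t * w - s%:P * q * f) * f ^+ k).
    have -> : (r%:P * t * w - s%:P * q * f) * f ^+ k =
      s%:P * (r%:P * (t * z) - q * f ^+ k.+1) - r%:P * t * (s%:P * z - w * f ^+ k).
      by rewrite exprS; ring.
    by apply: (idealB ipP); apply: (idealMl _ ipP).
  by move/(prime_idealXN (poly_set_prime pP) nPf).
have Qw : Q w.
  have : Q (r%:P * t * w).
    rewrite -[_ * w](subrK (s%:P * q * f)).
    by apply: idealD => //; [apply: PQ|apply: idealMl].
  case/(prime_idealM pQ) => // /(prime_idealM pQ)[] //.
  by rewrite -[Q _]/(contraction Q r) QP.
have [u [v [Pu Pv]]] := Q1 _ Qw.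
exists (u * s), v; split; first exact: prime_idealMN.
have -> : (u * s)%:P * z - v * f ^+ k.+1 =
   u%:P * (s%:P * z - w * f ^+ k) + (u%:P * w - v * f ^+ 1) * f ^+ k.
  by rewrite polyCM exprS expr1; ring.
by apply: (idealD ipP); [apply: (idealMl _ ipP)|apply: (idealMr _ ipP)].
Qed.

(* Krull's principal ideal theorem for A[X]/P'[X]: with a in P \ P', the prime
   P[X] is minimal over P'[X] + (a), so the symbolic powers of Q stabilize
   modulo a, hence stabilize by Nakayama's lemma, which is absurd. *)
Lemma poly_prime_adjacent P' P Q : prime_ideal P' -> prime_ideal P -> P' `<` P ->
  (forall R, prime_ideal R -> P' `<=` R -> R `<=` P -> R = P' \/ R = P) ->
  sat_noetherian (~` P) -> prime_ideal Q ->
  poly_set P' `<=` Q -> Q `<` poly_set P -> Q = poly_set P'.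
Proof.
move=> pP' pP [P'P nPP'] adj nP pQ P'Q [QP nPQ]; apply: contrapT => neq.
have [iP iQ] := (prime_ideal_ideal pP, prime_ideal_ideal pQ).
have ipP' := poly_set_ideal (prime_ideal_ideal pP').
have ppP := poly_set_prime pP.
have npP : sat_noetherian (~` poly_set P).
  by apply: contraction_sat_noetherian; rewrite ?contraction_poly_set.
have P'cQ : P' `<=` contraction Q.
  by rewrite -[P']contraction_poly_set; [exact: contractionS|exact: prime_ideal_ideal].
have cQP : contraction Q `<=` P.
  by rewrite -[P]contraction_poly_set //; exact: contractionS.
have [QP'|cQ] := adj _ (contraction_prime pQ) P'cQ cQP; last first.
  by apply: nPQ; apply: poly_set_sub => //; rewrite cQ.
have [f [Qf nPf _ _ genf]] := poly_prime_generator pP' iQ P'Q QP' neq.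
have Q1 g : Q g -> symb P' f 1 g.
  by move=> /genf[s [q [Ps Pq _]]]; exists s, q; rewrite expr1.
have symbP k : sat_ideal (~` poly_set P) (symb P' f k).
  split; first exact: symb_ideal.
  by move=> t z nPt; apply: (symb_sat pP' pQ) => // /QP.
have P'symb k : poly_set P' `<=` symb P' f k.
  move=> z P'z; exists 1, 0; split; first exact: prime_ideal1.
  by rewrite mul1r mul0r subr0.
have /existsNP[a /not_implyP[Pa nP'a]] : ~ (P `<=` P') by [].
pose c k := sat_add (poly_set P) a%:P (symb P' f k).
have Ppa : poly_set P a%:P by rewrite -[_ a%:P]/(contraction (poly_set P) a) contraction_poly_set.
have [|k|k z [/(P'symb k)|->]|k|N cN] := @sat_artinian _ _ (poly_set P' `|` [set a%:P]) c ppP npP.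
(* By adjacency [q] contracts to [P'] or [P]; the element [a] excludes [P'], and [P] gives q =
   P[X]. *)
- move=> q pq Jq qP; have iq := prime_ideal_ideal pq.
  have P'q : P' `<=` contraction q.
    rewrite -[P']contraction_poly_set; last exact: prime_ideal_ideal.
    by apply: contractionS => z P'z; apply: Jq; left.
  have cqP : contraction q `<=` P.
    by rewrite -[P]contraction_poly_set //; exact: contractionS.
  have [cq|cq] := adj _ (contraction_prime pq) P'q cqP.
    by case: nP'a; rewrite -cq; apply: Jq; right.
  by apply/seteqP; split=> //; apply: poly_set_sub => //; rewrite cq.
- by apply: sat_add_ideal => //; case: (symbP k).
- by move=> kz; apply: (sub_sat_add _ ppP kz).
- by apply: mem_sat_add => //; case: (symbP k).
- exact: sat_addS.
(* If sz - ba is in the power of exponent N + 1, then ba is in that of exponent [N], and so is [b]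
   because [a] is outside [P']: this is the hypothesis of Nakayama's lemma. *)
have : symb P' f N `<=` symb P' f N.+1.
  apply: (@sat_nakayama _ (poly_set P) a%:P) => // z zN.
  have [s [b [Ps zb]]] := cN z (sub_sat_add _ ppP zN).
  exists s, b; split; [by []| |by rewrite [a%:P * b]mulrC].
  have [iN _] := symbP N; apply: (@symb_satC _ _ _ a) => //.
  have -> : a%:P * b = s * z - (s * z - b * a%:P) by ring.
  by apply: idealB => //; [apply: idealMl|apply: symbS].
(* For [f ^+ N] the inclusion gives, after cancellation, s - qf in P'[X] with [s] outside [P']; but
   then the constant [s] is in [Q], hence in [P']. *)
move=> /(_ (f ^+ N))[].
  exists 1, 1; split; first exact: prime_ideal1.
  by rewrite subrr; apply: (ideal0 ipP').
move=> s [q [nP's]].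
have -> : s%:P * f ^+ N - q * f ^+ N.+1 = (s%:P - q * f) * f ^+ N.
  by rewrite exprS; ring.
case/(prime_idealM (poly_set_prime pP')) => [P'sq|]; last first.
  exact: (prime_idealXN (poly_set_prime pP')).
apply: nP's; rewrite -QP' /contraction /= -[s%:P](subrK (q * f)).
by apply: idealD => //; [apply: P'Q|apply: idealMl].
Qed.

End KrullPoly.

(** * Heights of primes *)

Section Height.
Variable A : idomainType.

Fixpoint height_ge k (P : set A) : Prop :=
  prime_ideal P /\
  if k is k'.+1 then exists2 P', P' `<` P & height_ge k' P' else True.

Lemma height_ge_prime k P : height_ge k P -> prime_ideal P.
Proof. by case: k => [|k] []. Qed.

End Height.

Section PolyHeight.
Variable A : idomainType.
Implicit Types (P : set A) (Q : set {poly A}).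

Lemma height_ge_poly_set k P : height_ge k P -> height_ge k (poly_set P).
Proof.
elim: k P => [|k IH] P [pP hP]; (split; first exact: poly_set_prime) => //.
have [P' [P'P nPP'] hP'] := hP; exists (poly_set P'); last exact: IH.
split; first exact: poly_setS.
move=> /contractionS; rewrite !contraction_poly_set //; apply: prime_ideal_ideal => //.
exact: height_ge_prime hP'.
Qed.

(* In both parts a chain in A[X] is pushed down to A: a step of the chain which
   is lost under contraction is either unique, at the top, or recovered from
   [poly_prime_adjacent]. *)
Lemma height_ge_contract_aux k P : sat_noetherian (~` P) ->
  (prime_ideal P -> height_ge k (poly_set P) -> height_ge k P) /\
  (forall Q, height_ge k.+1 Q -> contraction Q = P -> height_ge k P).
Proof.
(* Strong induction, since the first part uses the second one two steps below, while the second uses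
   the first at the same [k]. *)
elim/ltn_ind: k P => k IH P nP.
have a_k : prime_ideal P -> height_ge k (poly_set P) -> height_ge k P.
  case: k IH => [|k] IH pP; first by split.
  move=> [_ [Q' [Q'P nPQ'] hQ']]; split=> //.
  have pQ' := height_ge_prime hQ'; have iQ' := prime_ideal_ideal pQ'.
  have [pP' iP] := (contraction_prime pQ', prime_ideal_ideal pP).
  have P'P : contraction Q' `<` P.
    split; first by rewrite -[P]contraction_poly_set //; apply: contractionS.
    by move=> PP'; apply: nPQ'; apply: poly_set_sub.
  have nP' : sat_noetherian (~` contraction Q').
    by apply: sat_noetherianS nP; apply: subsetC; case: P'P.
  have [IHa _] := IH k (ltnSn k) _ nP'.
  have [Q'E|neq] := pselect (Q' = poly_set (contraction Q')).
    by exists (contraction Q') => //; apply: IHa => //; rewrite -Q'E.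
  have P'Q' : poly_set (contraction Q') `<=` Q' by apply: poly_set_sub.
  case: k IH IHa hQ' => [|k] IH IHa hQ'; first by exists (contraction Q').
  have [_ IHb] := IH k (ltnW (ltnSn k.+1)) _ nP'.
  have hP' := IHb _ hQ' erefl.
  (* Contracting [Q'] has cost one step. It is regained from a prime strictly between: without one,
     [poly_prime_adjacent] would make [Q'] extended from its contraction. *)
  have [R [pR P'R RP]] : exists R, [/\ prime_ideal R, contraction Q' `<` R & R `<` P].
    apply: contrapT => noR; apply: neq.
    apply: (poly_prime_adjacent pP' pP P'P) => // R pR P'R RP.
    have [->|nR] := pselect (R = contraction Q'); [by left|right].
    apply: contrapT => nRP; apply: noR; exists R; split=> //; split=> // h.
      by apply: nR; apply/seteqP.
    by apply: nRP; apply/seteqP.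
  by exists R => //; split=> //; exists (contraction Q').
split=> // Q [pQ [Q' Q'Q hQ']] QP.
have pP : prime_ideal P by rewrite -QP; apply: contraction_prime.
have pQ' := height_ge_prime hQ'.
have Q'P : contraction Q' `<=` P by rewrite -QP; apply: contractionS; case: Q'Q.
(* If the top step is lost under contraction, then [Q'] is P[X] and the first part applies;
   otherwise the step survives and induction applies to [Q']. *)
have [Q'PE|neq] := pselect (contraction Q' = P).
  by apply: a_k => //; rewrite -(poly_prime_incomparable pP pQ' pQ Q'PE QP Q'Q).
case: k IH hQ' {a_k} => [|k] IH hQ'; first by split.
split=> //; exists (contraction Q').
  by split=> // h; apply: neq; apply/seteqP.
have nP' : sat_noetherian (~` contraction Q').
  by apply: sat_noetherianS nP; apply: subsetC.
by have [_] := IH k (ltnSn k) _ nP'; apply; [exact: hQ'|].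
Qed.

Lemma height_ge_contract k Q : sat_noetherian (~` contraction Q) ->
  height_ge k.+1 Q -> height_ge k (contraction Q).
Proof. by move=> /(height_ge_contract_aux k)[_] h /h; apply. Qed.

Lemma height_ge_polyX k P : height_ge k P ->
  exists2 Q, contraction Q = P & height_ge k.+1 Q.
Proof.
move=> hP; have pP := height_ge_prime hP; have iP := prime_ideal_ideal pP.
(* This is P + (X), strictly above P[X]. *)
exists [set f : {poly A} | P f`_0].
  by apply/seteqP; split=> x; rewrite /contraction /= coefC.
split.
  apply/prime_idealE; split; first (apply/idealP; split).
  - by rewrite /= coef0; apply: ideal0.
  - by move=> f g; rewrite /= coefD; apply: idealD.
  - by move=> f g; rewrite /= coefM big_ord1; apply: idealMl.
  - by rewrite /= coef1; apply: prime_ideal1.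
  - by move=> f g; rewrite /= coefM big_ord1; apply: prime_idealM.
exists (poly_set P); last exact: height_ge_poly_set.
split; first by move=> f; apply.
move=> /(_ 'X); rewrite /= coefX => /(_ (ideal0 iP))/(_ 1%N).
by rewrite coefX; apply: prime_ideal1.
Qed.

End PolyHeight.

Definition poly_primes (A : idomainType) (L : set (set A)) : set (set {poly A}) :=
  [set Q | prime_ideal Q /\ L (contraction Q)].

(** A finite-type condition: a prime outside [L] contains a finitely generated ideal that lies in no
    member of [L]. *)
Definition fin_detected (A : idomainType) (L : set (set A)) :=
  forall P, prime_ideal P -> ~ L P -> exists n (a : 'I_n -> A),
    (forall i, P (a i)) /\ forall P', L P' -> exists i, ~ P' (a i).

(** * Semistar operations *)

Section Tilde.
Variables (D : idomainType) (star : set {fraction D} -> set {fraction D}).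
Local Notation K := {fraction D}.
Implicit Types (P I M : set D).

(** The zero prime is included because chains start there and the condition of [Theta1] admits
    it. *)
Definition quasi_max_primes : set (set D) :=
  [set P | prime_ideal P /\
    (P = [set 0] \/ exists2 M, QMax (star_f star) M & P `<=` M)].

Lemma frac_inj : injective (frac : D -> K).
Proof. by move=> x y /eqP; rewrite tofrac_eq => /eqP. Qed.

Lemma QMax_ideal M : QMax (star_f star) M -> ideal M.
Proof. by case=> [[]]. Qed.

Lemma QMax1 M : QMax (star_f star) M -> ~ M 1.
Proof.
move=> qM M1; case: (qM) => _ + _; apply; apply/seteqP; split=> // x _.
by rewrite -[x]mulr1; apply: idealMl => //; apply: QMax_ideal.
Qed.

Lemma mulmod1 (E F : set K) x y : E x -> F y -> mulmod E F (x * y).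
Proof.
by move=> Ex Fy; exists 1%N, (fun=> x), (fun=> y); split=> //; rewrite big_ord1.
Qed.

(** Since [P] lies in [M], denominators outside [M] are outside [P]; so the single component at [M]
    already forces [x] into [I], after clearing a common denominator. *)
Lemma tilde_sat P M I : prime_ideal P -> QMax (star_f star) M -> P `<=` M ->
  sat_ideal (~` P) I -> frac @^-1` tilde star (frac @` I) = I.
Proof.
move=> pP qM PM [iI sI]; apply/seteqP; split=> x.
  move=> /(_ M qM)[n [e [f [Ie fM]]]].
  suff [s [b [Ps Ib]]] : exists s b, [/\ ~ P s, I b & (\sum_(i < n) e i * f i) * frac s = frac b].
    move=> + xE; rewrite -xE -tofracM => /frac_inj xs; apply: (sI s) => //.
    by rewrite mulrC xs.
  elim/big_ind: _ => [|y z [s [b [Ps Ib yE]]] [t [c [Pt Ic zE]]]|i _].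
  - exists 1, 0; split; [exact: prime_ideal1|exact: ideal0|].
    by rewrite mul0r tofrac0.
  - exists (s * t), (b * t + c * s); split; first exact: prime_idealMN.
      by apply: idealD => //; apply: idealMr.
    by rewrite tofracD !tofracM -yE -zE; ring.
  - have [b Ib <-] := Ie i; have [a [s [Ms ->]]] := fM i.
    have s0 : s != 0.
      by apply/eqP => s0; apply: Ms; rewrite s0; apply: (ideal0 (QMax_ideal qM)).
    exists s, (b * a); split; [by move=> /PM|exact: idealMr|].
    by rewrite -mulrA divfK ?tofrac_eq0 // tofracM.
move=> Ix N qN; rewrite -[frac x]mulr1; apply: mulmod1; first by exists x.
by exists 1, 1; split; [exact: QMax1|rewrite divff // tofrac_eq0 oner_eq0].
Qed.

Lemma quasi_prime_tildeP P :
  quasi_prime (tilde star) P <-> P <> [set 0] /\ quasi_max_primes P.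
Proof.
split=> [[[iP P0 Pt] pP]|[P0 [pP [//|[M qM PM]]]]]; last first.
  split=> //; split=> //; first exact: prime_ideal_ideal.
  apply: tilde_sat qM PM _ => //; split; first exact: prime_ideal_ideal.
  by move=> s a Ps /(prime_idealM pP)[].
split=> //; split=> //; right; apply: contrapT => nM; apply: (prime_ideal1 pP).
(* An element [s] of [P] outside [M] is invertible at [M], which puts 1 in the component at [M]. *)
rewrite -Pt => M qM; have /existsNP[s /not_implyP[Ps Ms]] : ~ (P `<=` M).
  by move=> PM; apply: nM; exists M.
have s0 : s != 0.
  by apply/eqP => s0; apply: Ms; rewrite s0; apply: (ideal0 (QMax_ideal qM)).
rewrite tofrac1 -(@divff _ (frac s)) ?tofrac_eq0 //; apply: mulmod1; first by exists s.
by exists 1, s; rewrite tofrac1 mul1r.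
Qed.

(** By [tilde_sat] nonzero saturated ideals are quasi-ideals, so initial zero terms are skipped. If
    P = 0, a nonzero saturated ideal is the whole ring. *)
Lemma tilde_sat_noetherian P : star_noetherian (tilde star) ->
  quasi_max_primes P -> sat_noetherian (~` P).
Proof.
move=> nt [pP qP] I sI IS; have iI k := proj1 (sI k).
have [I0|/existsNP[k0 nI0]] := pselect (forall k, I k = [set 0]).
  by exists 0%N => k _; rewrite !I0.
have nI0k k : I (k0 + k)%N <> [set 0].
  move=> Ik; apply: nI0; apply/seteqP; split; last by move=> _ ->; apply: ideal0.
  by rewrite -Ik; apply: chain_subset => //; apply: leq_addr.
suff [N IN] : exists N, forall k, (N <= k)%N -> I (k0 + k)%N = I (k0 + N)%N.
  exists (k0 + N)%N => k Nk; rewrite -(IN (k - k0)%N).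
    by rewrite subnKC // (leq_trans (leq_addr _ _) Nk).
  by rewrite leq_subRL // (leq_trans (leq_addr _ _) Nk).
case: qP => [P0|[M qM PM]].
  exists 0%N => k _; have Ik j : I (k0 + j)%N = setT.
    have /existsNP[x /not_implyP[Ix x0]] : ~ (I (k0 + j)%N `<=` [set 0]).
      move=> sub; apply: (nI0k j); apply/seteqP; split=> // _ ->; exact: ideal0.
    apply/seteqP; split=> // y _; have [_] := sI (k0 + j)%N; apply.
      by rewrite P0; apply: x0.
    exact: idealMr.
  by rewrite !Ik.
apply: nt => k; last by rewrite addnS.
by split=> //; apply: tilde_sat qM PM _.
Qed.

End Tilde.

(** * The finite-type operation and its maximal quasi-ideals *)

Section Semistar.
Variables (D : idomainType) (star : set {fraction D} -> set {fraction D}).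
Local Notation K := {fraction D}.
Hypothesis hstar : semistar star.
Implicit Types (P I M : set D) (E F : set K).

Lemma span_gen n (x : 'I_n -> K) i : span x (x i).
Proof.
exists (fun j => (j == i)%:R); rewrite (bigD1 i) //= eqxx tofrac1 mul1r big1 ?addr0 //.
by move=> j /negPf ->; rewrite tofrac0 mul0r.
Qed.

Lemma span_submodule n (x : 'I_n -> K) : submodule (span x).
Proof.
split.
- by exists (fun=> 0); rewrite big1 // => i _; rewrite tofrac0 mul0r.
- move=> _ _ [d ->] [e ->]; exists (fun i => d i + e i).
  by rewrite -big_split; apply: eq_bigr => i _; rewrite tofracD mulrDl.
- move=> c _ [d ->]; exists (fun i => c * d i).
  by rewrite mulr_sumr; apply: eq_bigr => i _; rewrite tofracM mulrA.
Qed.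

Lemma span_sub n (x : 'I_n -> K) E : submodule E -> (forall i, E (x i)) -> span x `<=` E.
Proof.
move=> [E0 ED EM] Ex _ [d ->]; elim/big_ind: _ => // i _; exact: EM.
Qed.

Lemma ideal_submodule I : ideal I -> submodule (frac @` I : set K).
Proof.
move=> iI; split.
- by exists 0; [exact: ideal0|rewrite tofrac0].
- by move=> _ _ [x Ix <-] [y Iy <-]; exists (x + y); [exact: idealD|rewrite tofracD].
- by move=> d _ [x Ix <-]; exists (d * x); [exact: idealMl|rewrite tofracM].
Qed.

Lemma subset_neq0 E F : F 0 -> E `<=` F -> E 0 -> E <> [set 0] -> F <> [set 0].
Proof.
move=> F0 EF E0 nE FE; apply: nE; apply/seteqP; split=> [x /EF|_ ->//].
by rewrite FE.
Qed.

Lemma span_Fbar n (x : 'I_n -> K) : span x <> [set 0] -> Fbar (span x).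
Proof. by move=> x0; split=> //; apply: span_submodule. Qed.

Lemma setT_Fbar : Fbar (frac @` [set: D] : set K).
Proof.
split; first by apply: ideal_submodule; apply/idealP.
move=> /seteqP[h _]; have /eqP : [set 0 : K] 1 by apply: h; exists 1; rewrite ?tofrac1.
by rewrite oner_eq0.
Qed.

Lemma star_fP I z : ideal I -> star_f star (frac @` I) z <->
  exists n (a : 'I_n -> D), [/\ forall i, I (a i),
    span (fun i => frac (a i)) <> [set 0] & star (span (fun i => frac (a i))) z].
Proof.
move=> iI; split=> [[_ [[[n [x ->]] x0] xI] sz]|[n [a [Ia a0 sz]]]].
  have /choice[a aP] i : exists a, I a /\ frac a = x i.
    by have [a Ia <-] := xI _ (span_gen x i); exists a.
  have xE : (fun i => frac (a i)) = x by apply/funext => i; case: (aP i).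
  by exists n, a; rewrite xE; split=> // i; case: (aP i).
exists (span (fun i => frac (a i))) => //; split.
  by split=> //; exists n, (fun i => frac (a i)).
by apply: span_sub; [exact: ideal_submodule|move=> i; exists (a i)].
Qed.

Lemma star_fS I J : I `<=` J -> star_f star (frac @` I) `<=` star_f star (frac @` J).
Proof.
move=> IJ z [F [fF FI] sz]; exists F => //; split=> // y /FI[x /IJ Jx <-].
by exists x.
Qed.

Lemma star_f_ext I x : ideal I -> I <> [set 0] -> I x -> star_f star (frac @` I) (frac x).
Proof.
move=> iI nI Ix; have [Fs _ _ Es] := hstar.
have /existsNP[y /not_implyP[Iy /eqP y0]] : ~ (I `<=` [set 0]).
  by move=> sub; apply: nI; apply/seteqP; split=> // _ ->; exact: ideal0.
(* The nonzero [y] keeps the span nonzero even when x = 0. *)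
pose a (i : 'I_2) := if i == ord0 then x else y.
apply/star_fP => //; exists 2%N, a.
have nspan : span (fun i => frac (a i)) <> [set 0].
  move=> /seteqP[/(_ (frac y)) + _] => /(_ (@span_gen 2 (fun i => frac (a i)) (lift ord0 ord0))).
  by move/eqP; rewrite tofrac_eq0; apply/negP.
split=> //; first by move=> i; rewrite /a; case: ifP.
have [+ _] := Es _ (span_Fbar nspan); apply.
exact: (@span_gen 2 (fun i => frac (a i)) ord0).
Qed.

Lemma star_f_setT P : ideal P ->
  star_f star (frac @` P) 1 <-> star_f star (frac @` P) = star (frac @` [set: D]).
Proof.
move=> iP; have [Fs _ Ms Es] := hstar; split=> [[F [[[n [x ->]] x0] xP] s1]|->].
  have Fx := span_Fbar x0; have Fsx := Fs _ Fx.
  apply/seteqP; split=> z.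
    move=> [_ [[[k [y ->]] y0] yP]]; apply: Ms => //; [exact: span_Fbar|exact: setT_Fbar|].
    by move=> w /yP[v _ <-]; exists v.
  move=> sz; exists (span x); first by split=> //; split=> //; exists n, x.
  have [_ <-] := Es _ Fx; apply: Ms sz => //; first exact: setT_Fbar.
  move=> _ [d _ <-]; rewrite -[frac d]mulr1.
  by have [[_ _ +] _] := Fsx; apply.
have [+ _] := Es _ setT_Fbar; apply; exists 1 => //; exact: tofrac1.
Qed.

Lemma chain_fin_mem (T : Type) (C : set (set T)) n (a : 'I_n -> T) X0 :
  total_on C subset -> C X0 -> (forall i, (\bigcup_(X in C) X) (a i)) ->
  exists2 X, C X & X0 `<=` X /\ forall i, X (a i).
Proof.
move=> totC CX0; elim: n a => [|n IH] a Ca; first by exists X0 => //; split=> // -[].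
have [|X CX [X0X Xa]] := IH (a \o lift ord0); first by move=> i; apply: Ca.
have [Y CY Ya] := Ca ord0.
have [XY|YX] := totC _ _ CX CY.
  exists Y => //; split; first exact: subset_trans XY.
  by move=> i; case: (unliftP ord0 i) => [j ->|-> //]; apply: XY; apply: Xa.
exists X => //; split=> // i; case: (unliftP ord0 i) => [j ->|->]; last exact: YX.
exact: Xa.
Qed.

(** Zorn's lemma on the ideals above [I] whose closure omits 1: an increasing union is again such an
    ideal, because membership in [star_f] involves finitely many generators. *)
Lemma QMax_exists I : ideal I -> I <> [set 0] -> ~ star_f star (frac @` I) 1 ->
  exists2 M, QMax (star_f star) M & I `<=` M.
Proof.
move=> iI nI I1; have [Fs _ Ms Es] := hstar.
pose good M := [/\ ideal M, I `<=` M & ~ star_f star (frac @` M) 1].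
have [C Cgood totC|M [MP Mmax]] := @Zorn_bigcup _ [set X | X = set0 \/ good X].
  have [C0|/existsNP[X0 /not_implyP[CX0 nX0]]] := pselect (forall X, C X -> X = set0).
    by left; apply/seteqP; split=> // x [X /C0 -> ].
  have CX0good X : C X -> X0 `<=` X -> good X.
    move=> CX X0X; case: (Cgood _ CX) => // Xe.
    by case: nX0; apply/seteqP; split=> // x; rewrite -Xe; apply: X0X.
  have iC : ideal (\bigcup_(X in C) X).
    apply/idealP; split.
    - by exists X0 => //; apply: ideal0; have [] := CX0good X0 CX0 (@subset_refl _ X0).
    - move=> x y Cx Cy; pose a (i : 'I_2) := if i == ord0 then x else y.
      have [|X CX [X0X Xa]] := @chain_fin_mem _ C 2 a X0 totC CX0.
        by move=> i; rewrite /a; case: ifP.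
      have [iX _ _] := CX0good _ CX X0X; exists X => //.
      by apply: idealD => //; [exact: (Xa ord0)|exact: (Xa (lift ord0 ord0))].
    - move=> c x Cx; have [|X CX [X0X Xa]] := @chain_fin_mem _ C 1 (fun=> x) X0 totC CX0.
        by [].
      have [iX _ _] := CX0good _ CX X0X; exists X => //.
      by apply: idealMl => //; exact: (Xa ord0).
  right; split=> //.
    by have [_ IX0 _] := CX0good _ CX0 (@subset_refl _ X0); move=> x /IX0; exists X0.
  move=> /(star_fP _ iC)[n [a [Ca a0 s1]]].
  have [X CX [X0X Xa]] := chain_fin_mem totC CX0 Ca.
  have [iX _] := CX0good _ CX X0X; apply.
  by apply/star_fP => //; exists n, a.
have {MP} [iM IM M1] : good M.
  case: MP => // M0; case: (Mmax I); last by right; split.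
  by rewrite M0; split=> [x []|/(_ 0 (ideal0 iI))[]].
have nM : M <> [set 0].
  move=> M0; apply: nI; apply/seteqP; split; first by rewrite -M0.
  by move=> _ ->; apply: ideal0.
have maxM J : ideal J -> M `<` J -> star_f star (frac @` J) 1.
  move=> iJ MJ; apply: contrapT => J1; apply: (Mmax J MJ); right; split=> //.
  by apply: subset_trans IM _; case: MJ.
exists M => //; split.
- split=> //; apply/seteqP; split=> z; last exact: star_f_ext.
  move=> /(star_fP _ iM)[k [b [Mb b0 sz]]]; apply: contrapT => nMz.
  pose J : set D := [set w | exists m c, M m /\ w = m + c * z].
  have iJ : ideal J.
    apply/idealP; split.
    - by exists 0, 0; split; [exact: ideal0|rewrite mul0r addr0].
    - move=> _ _ [m [c [Mm ->]]] [m' [c' [Mm' ->]]].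
      by exists (m + m'), (c + c'); split; [exact: idealD|ring].
    - move=> d _ [m [c [Mm ->]]].
      by exists (d * m), (d * c); split; [exact: idealMl|ring].
  have MJ : M `<` J.
    split; first by move=> m Mm; exists m, 0; rewrite mul0r addr0.
    by move=> /(_ z) h; apply: nMz; apply: h; exists 0, 1; rewrite mul1r add0r; split=> //; apply: ideal0.
  have /(star_fP _ iJ)[n [a [Ja a0 s1]]] := maxM _ iJ MJ.
  have [m /choice[c mc]] := choice Ja.
  (* The parts in [M] of the generators of J = M + zD are joined with the generators witnessing [z]
     in the closure of [M]; the closure of their span then contains [z], all [a i], and so 1. *)
  pose h i := match split i with inl j => m j | inr j => b j end.
  pose H := span (fun i => frac (h i)).
  have Hm i : H (frac (m i)).
    by have := span_gen (fun i => frac (h i)) (lshift k i); rewrite /h (unsplitK (inl i)).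
  have Hb i : H (frac (b i)).
    by have := span_gen (fun i => frac (h i)) (rshift n i); rewrite /h (unsplitK (inr i)).
  have sH : submodule H := span_submodule _.
  have bH : span (fun i => frac (b i)) `<=` H by apply: span_sub.
  have nH : H <> [set 0].
    by apply: subset_neq0 bH _ b0; [case: sH|case: (span_submodule (fun i => frac (b i)))].
  have FH : Fbar H by split.
  have [[sH0 sHD sHM] _] := Fs _ FH.
  have [HsH sHH] := Es _ FH.
  apply: M1; apply/star_fP => //; exists (n + k)%N, h; split=> //.
    by move=> i; rewrite /h; case: split => j //; case: (mc j).
  rewrite -/H -sHH; apply: (Ms _ _ _ _ _ _ s1); [exact: span_Fbar|exact: Fs|].
  apply: span_sub => // i; have [_ ->] := mc i; rewrite tofracD tofracM.
  apply: sHD; first exact: HsH.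
  by apply: sHM; apply: (Ms _ _ _ _ bH _ sz) => //; apply: span_Fbar.
- move=> MT; apply: M1; rewrite -tofrac1; apply: star_f_ext => //.
  by rewrite MT.
- move=> J [iJ nJ Jq] nJT MJ; apply: contrapT => JM.
  have J1 : star_f star (frac @` J) 1.
    by apply: maxM => //; split=> // JM'; apply: JM; apply/seteqP.
  apply: nJT; apply/seteqP; split=> // x _; rewrite -[x]mulr1; apply: idealMl => //.
  by rewrite -Jq /= tofrac1.
Qed.

Lemma QMax_star_f1 M : QMax (star_f star) M -> ~ star_f star (frac @` M) 1.
Proof.
by move=> qM sM1; apply: (QMax1 qM); have [[_ _ <-] _ _] := qM; rewrite /= tofrac1.
Qed.

Lemma quasi_max_primesE P : prime_ideal P ->
  (P = [set 0] \/ star_f star (frac @` P) `<` star (frac @` [set: D])) <->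
  quasi_max_primes star P.
Proof.
move=> pP; have iP := prime_ideal_ideal pP.
have [P0|nP] := pselect (P = [set 0]); first by split=> _; [split=> //|]; left.
split=> [[//|[sub nsub]]|[_ [//|[M qM PM]]]].
  split=> //; right; apply: QMax_exists => //.
  by move=> /(star_f_setT iP) sE; apply: nsub; rewrite sE.
right; have [Fs _ Ms _] := hstar; split.
  move=> z [F [fF FP]]; apply: Ms; [|exact: setT_Fbar|].
    by case: fF => -[n [x ->]]; apply: span_Fbar.
  by move=> w /FP[v _ <-]; exists v.
move=> sub; apply: (QMax_star_f1 qM); apply: (star_fS PM); apply: sub.
have [+ _] := (let: And4 _ _ _ h := hstar in h) _ setT_Fbar; apply.
by exists 1 => //; apply: tofrac1.
Qed.

(** The closure of [P] contains 1, and finitely many elements of [P] suffice for that; no member of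
    [QMax] can contain them all. *)
Lemma quasi_max_primes_fin_detected : fin_detected (quasi_max_primes star).
Proof.
move=> P pP nP; have iP := prime_ideal_ideal pP.
have : star_f star (frac @` P) 1.
  apply: contrapT => P1; apply: nP; split=> //.
  have [P0|nP] := pselect (P = [set 0]); [by left|right].
  exact: QMax_exists.
move=> /(star_fP _ iP)[n [a [Pa a0 s1]]]; exists n, a; split=> // P' [pP' P'M].
apply: contrapT => /forallNP nP'.
have {nP'} P'a i : P' (a i) by apply: contrapT; apply: nP'.
case: P'M => [P'0|[M qM P'M]].
  apply: a0; apply/seteqP; split.
    apply: span_sub.
      by split=> //= [x y -> ->|d x ->]; rewrite ?addr0 ?mulr0.
    by move=> i /=; have := P'a i; rewrite P'0 => ->; rewrite tofrac0.
  by move=> _ ->; case: (span_submodule (fun i => frac (a i))).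
apply: (QMax_star_f1 qM); apply/star_fP; first exact: QMax_ideal qM.
by exists n, a; split=> // i; apply: P'M.
Qed.

End Semistar.

Section FracLemmas.
Variable R : idomainType.
Implicit Types p s t z : R.

Lemma frac_div1 p : frac p = frac p / frac 1.
Proof. by rewrite tofrac1 divr1. Qed.

Lemma frac_divMr p s t : t != 0 -> frac p / frac s = frac (p * t) / frac (s * t).
Proof. by move=> t0; rewrite !tofracM -mulf_div divff ?mulr1 // tofrac_eq0. Qed.

Lemma frac_eq_div z p s : s != 0 -> frac z = frac p / frac s -> z * s = p.
Proof. by move=> s0 zE; apply: frac_inj; rewrite tofracM zE divfK // tofrac_eq0. Qed.

Lemma map_frac1 : map_poly frac (1 : {poly R}) = 1.
Proof.
apply/polyP => i; rewrite coef_map [RHS]coef1 coef1.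
by case: (i == 0%N) => /=; [exact: tofrac1|exact: tofrac0].
Qed.

Lemma map_fracM (p q : {poly R}) :
  map_poly frac (p * q) = map_poly frac p * map_poly frac q.
Proof. exact: rmorphM. Qed.

Lemma map_frac_neq0 (p : {poly R}) : p != 0 -> map_poly frac p != 0.
Proof.
apply: contraNneq => /polyP p0; apply/eqP/polyP => i.
by have := p0 i; rewrite coef_map !coef0 => /eqP; rewrite tofrac_eq0 => /eqP.
Qed.

End FracLemmas.

(** * Quasi-primes of star[X] *)

Section StarX.
Variables (A : idomainType) (star : set {fraction A} -> set {fraction A}).
Local Notation A1 := {poly A}.
Local Notation K1 := {fraction {poly A}}.
Implicit Types (Q : set A1) (E F : set K1).

Lemma contraction_zero : contraction [set 0 : A1] = [set 0].
Proof.
by apply/seteqP; split=> x /=; [move/eqP; rewrite polyC_eq0 => /eqP|move=> ->].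
Qed.

Lemma Theta1_zero : Theta1 star [set 0].
Proof.
by split; [exact: prime_ideal_zero|left; apply: contraction_zero].
Qed.

Lemma S1P (s : {poly A1}) :
  S1 star s <-> forall Q, Theta1 star Q -> ~ poly_set Q s.
Proof.
split=> [nS Q TQ Qs|nS [Q TQ Qs]]; first by apply: nS; exists Q.
exact: nS Q TQ Qs.
Qed.

Lemma S1_1 : S1 star 1.
Proof.
apply/S1P => Q [pQ _] /(_ 0%N); rewrite coef1 /=; exact: prime_ideal1.
Qed.

Lemma S1M s t : S1 star s -> S1 star t -> S1 star (s * t).
Proof.
move=> /S1P Ss /S1P St; apply/S1P => Q TQ.
by apply: prime_idealMN (Ss Q TQ) (St Q TQ); case: TQ => pQ _; apply: poly_set_prime.
Qed.

Lemma S1_neq0 s : S1 star s -> s != 0.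
Proof.
move=> /S1P/(_ _ Theta1_zero) Ss; apply/eqP => s0; apply: Ss => i.
by rewrite s0 coef0.
Qed.

Lemma star_XS E F : E `<=` F -> star_X star E `<=` star_X star F.
Proof.
move=> EF c [p [s [Ep Ss cE]]]; exists p, s; split=> // i; exact: EF.
Qed.

Lemma sub_star_X E : E 0 -> E `<=` star_X star E.
Proof.
move=> E0 c Ec; exists c%:P, 1; split; [|exact: S1_1|].
  by move=> i; rewrite coefC; case: ifP.
by rewrite map_frac1; exact: frac_div1.
Qed.

(** Some coefficient of the denominator [s] is outside [Q]; the coefficient of the same index in zs
    = p lies in [Q]. *)
Lemma star_X_Theta1 Q z : Theta1 star Q -> star_X star (frac @` Q) (frac z) -> Q z.
Proof.
move=> TQ [p [s [Qp Ss zE]]]; have s0 := map_frac_neq0 (S1_neq0 Ss).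
have {}zE := frac_eq_div s0 zE.
have /existsNP[i nQs] := (S1P s).1 Ss _ TQ.
have := Qp i; rewrite -zE coefCM coef_map -tofracM => -[w Qw /frac_inj wE].
by have [pQ _] := TQ; move: Qw; rewrite wE => /(prime_idealM pQ)[].
Qed.

(** The polynomial in Y with coefficients [a i] belongs to [S1]. Multiplying numerator and
    denominator by it moves the numerator into the span. *)
Lemma star_X_detected n (a : 'I_n -> A1) :
  (forall Q, Theta1 star Q -> exists i, ~ Q (a i)) ->
  star_X star (frac @` [set: A1]) `<=` star_X star (span (fun i => frac (a i))).
Proof.
move=> Ta c [p [s [Ap Ss cE]]].
pose t : {poly A1} := \sum_(i < n) (a i)%:P * 'X^i.
have tE i : t`_i = if insub i is Some j then a j else 0.
  rewrite coef_sum; under eq_bigr => j _ do rewrite coefCM coefXn.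
  case: insubP => [j _ <-|ni].
    rewrite (bigD1 j) //= eqxx mulr1 big1 ?addr0 // => k.
    by rewrite -val_eqE eq_sym /= => /negPf ->; rewrite mulr0.
  rewrite big1 // => j _; rewrite gtn_eqF ?mulr0 //.
  by rewrite -leqNgt in ni; apply: leq_trans (ltn_ord j) ni.
have St : S1 star t.
  apply/S1P => Q TQ Qt; have [i nQ] := Ta _ TQ; apply: nQ.
  by have := Qt i; rewrite tE valK.
exists (p * map_poly frac t), (s * t); split; [|exact: S1M|].
  move=> i; rewrite coefM; have [span0 spanD spanM] := span_submodule (fun i => frac (a i)).
  elim/big_ind: _ => // j _; have [b _ <-] := Ap j; rewrite coef_map tE.
  apply: spanM; case: insub => [k|]; first exact: span_gen.
  by rewrite /= tofrac0.
by rewrite cE map_fracM; apply: frac_divMr; apply: map_frac_neq0; apply: S1_neq0.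
Qed.

Hypothesis det : fin_detected (Theta1 star).

Lemma star_X_nTheta1 Q : prime_ideal Q -> ~ Theta1 star Q ->
  star_f (star_X star) (frac @` Q) = star_X star (frac @` [set: A1]) /\
  star_X star (frac @` Q) = star_X star (frac @` [set: A1]).
Proof.
move=> pQ nTQ; have iQ := prime_ideal_ideal pQ.
have [n [a [Qa Ta]]] := det pQ nTQ; have sub := star_X_detected Ta.
have spanQ : span (fun i => frac (a i)) `<=` frac @` Q.
  by apply: span_sub => [|i]; [exact: ideal_submodule|exists (a i)].
have QT : frac @` Q `<=` (frac @` [set: A1] : set K1) by apply: image_subset.
split; apply/seteqP; split.
- move=> z [F [_ FQ]]; apply: star_XS; exact: subset_trans QT.
- move=> z /sub sz; exists (span (fun i => frac (a i))) => //; split=> //.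
  split; first by exists n, (fun i => frac (a i)).
  move=> span0; have [i] := Ta _ Theta1_zero; apply; apply: frac_inj.
  by rewrite tofrac0; have := span_gen (fun i => frac (a i)) i; rewrite span0.
- exact: star_XS.
- by apply: subset_trans sub _; apply: star_XS.
Qed.

Lemma quasi_prime_star_XP Q :
  quasi_prime (star_X star) Q <-> Q <> [set 0] /\ Theta1 star Q.
Proof.
split=> [[[iQ nQ QE] pQ]|[nQ TQ]].
  split=> //; apply: contrapT => nTQ; apply: (prime_ideal1 pQ).
  rewrite -QE /=; have [_ ->] := star_X_nTheta1 pQ nTQ.
  by apply: sub_star_X; [exists 0; rewrite ?tofrac0|exists 1].
have [pQ _] := TQ; have iQ := prime_ideal_ideal pQ; split=> //; split=> //.
apply/seteqP; split=> z; first exact: star_X_Theta1.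
move=> Qz; apply: sub_star_X; last by exists z.
by exists 0; [exact: ideal0|rewrite tofrac0].
Qed.

(** This drives the induction on indeterminates: outside [Theta1] a contraction has the same closure
    as the whole ring, inside it the closure omits 1. *)
Lemma Theta1_star_X : Theta1 (star_X star) = poly_primes (Theta1 star).
Proof.
apply/seteqP; split=> R [pR TR]; split=> //; have pQ := contraction_prime pR.
  apply: contrapT => nT; case: TR => [Q0|[_]].
    by apply: nT; rewrite /contraction Q0; apply: Theta1_zero.
  by apply; rewrite -/(contraction R); have [-> _] := star_X_nTheta1 pQ nT.
right; split=> [z [F [_ FQ] zF]|sub].
  by apply: (star_XS _ zF) => w /FQ[v _ <-]; exists v.
apply: (prime_ideal1 pQ); apply: (star_X_Theta1 TR).
have /sub[F [_ FQ]] : star_X star (frac @` [set: A1]) (frac 1).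
  by apply: sub_star_X; [exists 0; rewrite ?tofrac0|exists 1].
exact: star_XS.
Qed.

End StarX.

Lemma poly_primes_fin_detected (A : idomainType) (L : set (set A)) :
  fin_detected L -> fin_detected (poly_primes L).
Proof.
move=> det Q pQ nQ; have [|n [a [Qa La]]] := det _ (contraction_prime pQ).
  by move=> LQ; apply: nQ.
by exists n, (fun i => (a i)%:P); split=> // Q' [_ /La].
Qed.

(** * Dimension *)

Section IterPolyPrimes.
Variables (D : idomainType) (L : set (set D)).

Fixpoint iter_poly_primes m : set (set (mpolyring D m)) :=
  match m return set (set (mpolyring D m)) with
  | 0%N => L
  | m'.+1 => poly_primes (@iter_poly_primes m')
  end.

End IterPolyPrimes.

Arguments iter_poly_primes {D} L m _.

(** Closure under smaller primes makes heights among all primes agree with heights inside [L]. *)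
Definition noetherian_primes (A : idomainType) (L : set (set A)) :=
  [/\ L [set 0], forall P, L P -> prime_ideal P,
    forall P P', L P -> prime_ideal P' -> P' `<=` P -> L P'
    & forall P, L P -> sat_noetherian (~` P)].

Section Dimension.
Variable A : idomainType.
Implicit Types L : set (set A).

Lemma poly_primes_noetherian L : noetherian_primes L -> noetherian_primes (poly_primes L).
Proof.
move=> [L0 Lp LS Ln]; split.
- by split; [exact: prime_ideal_zero|rewrite contraction_zero].
- by move=> Q [].
- move=> Q Q' [_ LQ] pQ' Q'Q; split=> //.
  by apply: (LS _ _ LQ); [exact: contraction_prime|exact: contractionS].
- by move=> Q [pQ LQ]; apply: contraction_sat_noetherian => //; apply: Ln.
Qed.

Lemma poly_primes_height L k : noetherian_primes L ->
  (exists2 Q, poly_primes L Q & height_ge k.+1 Q) <->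
  (exists2 P, L P & height_ge k P).
Proof.
move=> [L0 Lp LS Ln]; split=> [[Q [pQ LQ] hQ]|[P LP hP]].
  by exists (contraction Q) => //; apply: height_ge_contract hQ; apply: Ln.
have [Q QP hQ] := height_ge_polyX hP; exists Q => //.
by split; [exact: height_ge_prime hQ|rewrite QP].
Qed.

Lemma prime_chainP (star : set {fraction A} -> set {fraction A}) L k :
  (forall P, quasi_prime star P <-> P <> [set 0] /\ L P) ->
  noetherian_primes L ->
  prime_chain star k <-> exists2 P, L P & height_ge k P.
Proof.
move=> qL [L0 Lp LS _]; split=> [[P [P0 PS]]|[P LP hP]].
  suff : forall i, (i <= k)%N -> L (P i) /\ height_ge i (P i).
    by move=> /(_ k (leqnn k))[]; exists (P k).
  elim=> [_|i IH ik]; first by rewrite P0; split=> //; split=> //; exact: prime_ideal_zero.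
  have [_ hi] := IH (ltnW ik); have [lt /qL[_ LPi]] := PS i ik.
  by split=> //; split; [exact: Lp|exists (P i)].
(* Only an inclusion in [P] is claimed at the top: the chain has to start at 0, while the lowest
   prime witnessing [height_ge] may be nonzero. *)
suff [c [c0 cS _]] : exists c : nat -> set A, [/\ c 0%N = [set 0],
    forall i, (i < k)%N -> c i `<` c i.+1 /\ quasi_prime star (c i.+1) & c k `<=` P].
  by exists c.
elim: k P LP hP => [|k IH] P LP.
  move=> [pP _]; exists (fun=> [set 0]); split=> // _ ->.
  by apply: ideal0; apply: prime_ideal_ideal.
move=> [pP [P' [P'P nPP'] hP']].
have [c [c0 cS cP']] := IH P' (LS _ _ LP (height_ge_prime hP') P'P) hP'.
exists (fun i => if (i <= k)%N then c i else P); split=> //; last by rewrite /= ltnn.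
move=> i; rewrite ltnS => ik; rewrite /= ik; case: ltnP => ki; first exact: cS.
have -> : i = k by apply/eqP; rewrite eqn_leq ik.
split; first split.
- exact: subset_trans P'P.
- by move=> Pc; apply: nPP'; apply: subset_trans cP'.
- apply/qL; split=> // P0; apply: nPP'; rewrite P0 => _ ->.
  by apply: ideal0; apply: prime_ideal_ideal; apply: height_ge_prime hP'.
Qed.

Lemma prime_chain0 (star : set {fraction A} -> set {fraction A}) : prime_chain star 0.
Proof. by exists (fun=> [set 0]). Qed.

Lemma prime_chainW (star : set {fraction A} -> set {fraction A}) j k :
  (j <= k)%N -> prime_chain star k -> prime_chain star j.
Proof.
by move=> jk [P [P0 PS]]; exists P; split=> // i ij; apply: PS; apply: leq_trans jk.
Qed.

Local Open Scope ereal_scope.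

(** Chain lengths are closed downwards, so the supremum is finite exactly when there is a last
    length, and equals it; otherwise it is [+oo]. *)
Lemma star_dimP (star : set {fraction A} -> set {fraction A}) n :
  star_dim star = (n%:Z)%:E <-> prime_chain star n /\ ~ prime_chain star n.+1.
Proof.
set C := [set (k%:Z)%:E | k in prime_chain star].
have nC : (C == set0) = false.
  apply/eqP => C0; have : C (0%N%:Z)%:E by exists 0%N; [exact: prime_chain0|].
  by rewrite C0.
have maxC m : prime_chain star m -> ~ prime_chain star m.+1 -> star_dim star = (m%:Z)%:E.
  move=> Cm nCm; rewrite /star_dim -/C /supremum nC.
  apply: xget_subset1; last exact: is_subset1_supremums.
  split; last by move=> u; apply; exists m.
  move=> _ [k Ck <-]; rewrite lee_fin lez_nat leqNgt; apply/negP => mk.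
  exact: nCm (prime_chainW mk Ck).
split=> [dimn|[]]; last exact: maxC.
have [all|/existsNP[k nCk]] := pselect (forall k, prime_chain star k).
  have : star_dim star = +oo.
    rewrite /star_dim -/C /supremum nC.
    apply: xget_subset1; last exact: is_subset1_supremums.
    split=> [u _|u uC]; first exact: leey.
    case: u uC => [u|//|] uC.
    + have : ((`|u|%N.+1)%:Z)%:E <= u%:E by apply: uC; exists (`|u|%N.+1).
      rewrite lee_fin => /le_trans/(_ (ler_norm u)).
      by rewrite -abszE lez_nat ltnn.
    + have : (0%N%:Z)%:E <= -oo :> \bar int by apply: uC; exists 0%N.
      by rewrite leNgt ltNyr.
  by rewrite dimn.
have [m Cm nCm] : exists2 m, prime_chain star m & ~ prime_chain star m.+1.
  apply: contrapT => /forall2NP h; apply: nCk; elim: k => [|k IH].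
    exact: prime_chain0.
  by case: (h k) => // /contrapT.
by move: (maxC m Cm nCm); rewrite dimn => -[] ->.
Qed.

End Dimension.

(** * Iteration over the indeterminates *)

Section Main.
Variables (D : idomainType) (star : set {fraction D} -> set {fraction D}).
Hypothesis hstar : semistar star.

Local Notation L := (iter_poly_primes (quasi_max_primes star)).

Lemma iter_poly_primes_fin_detected m : fin_detected (L m).
Proof.
elim: m => [|m IH]; first exact: quasi_max_primes_fin_detected.
exact: poly_primes_fin_detected.
Qed.

(** The index shifts because [Theta1] of an operation consists of primes with one more
    indeterminate. *)
Lemma Theta1_star_Xs m : Theta1 (star_Xs star m) = L m.+1.
Proof.
elim: m => [|m IH]; last first.
  rewrite [LHS]Theta1_star_X ?IH //.
  exact: (@iter_poly_primes_fin_detected m.+1).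
apply/seteqP; split=> Q [pQ TQ]; split=> //.
  by apply/quasi_max_primesE => //; apply: contraction_prime.
by apply/quasi_max_primesE => //; apply: contraction_prime.
Qed.

Lemma iter_poly_primes_noetherian m : star_noetherian (tilde star) ->
  noetherian_primes (L m).
Proof.
move=> nt; elim: m => [|m IH]; last exact: poly_primes_noetherian.
split.
- by split; [exact: prime_ideal_zero|left].
- by move=> P [].
- move=> P P' [pP [P0|[M qM PM]]] pP' P'P; split=> //; [left|right].
    apply/seteqP; split; first by rewrite -P0.
    by move=> _ ->; apply: ideal0; apply: prime_ideal_ideal.
  by exists M => //; apply: subset_trans PM.
- by move=> P; apply: tilde_sat_noetherian.
Qed.

Lemma iter_poly_primes_height m k : star_noetherian (tilde star) ->
  (exists2 Q, L m Q & height_ge (k + m) Q) <->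
  (exists2 P, L 0 P & height_ge k P).
Proof.
move=> nt; elim: m => [|m IH]; first by rewrite addn0.
rewrite addnS -IH; apply: poly_primes_height; exact: iter_poly_primes_noetherian.
Qed.

End Main.

Theorem theorem3p2 (D : idomainType)
    (star : set {fraction D} -> set {fraction D}) (n m : nat)
    (hstar : semistar star)
    (hnoeth : star_noetherian (tilde star))
    (hdim : star_dim (tilde star) = (n%:Z)%:E)
    (hm : (1 <= m)%N) :
  star_dim (star_Xs star m) = ((n + m)%N%:Z)%:E.
Proof.
have nL k := iter_poly_primes_noetherian k hnoeth.
have chain0 k : prime_chain (tilde star) k <->
    prime_chain (star_Xs star m) (k + m)%N.
  rewrite (prime_chainP k (@quasi_prime_tildeP D star) (nL 0%N)).
  (* For m >= 1 the outermost operation is a [star_X], so [quasi_prime_star_XP] describes its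
     quasi-primes. *)
  case: m hm => // m' _; rewrite (@prime_chainP _ _ _ _ _ (nL m'.+1)).
    by rewrite iter_poly_primes_height.
  move=> Q; rewrite -Theta1_star_Xs //; apply: quasi_prime_star_XP.
  rewrite Theta1_star_Xs //; exact: (iter_poly_primes_fin_detected hstar (m := m'.+1)).
move/star_dimP: hdim => [/chain0 Cn nCn]; apply/star_dimP; split=> //.
by move=> Cn1; apply: nCn; apply/chain0.
Qed.
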